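(* Let $E\geq 1$ and $K\geq 2$ be natural numbers. Then the Boltzmann-on-energy distribution $\mathrm{BoE}[E](K) := \mathrm{BoN}[E+1,K](E)$ satisfies $$\mathrm{BoE}[E](K) \;=\; \sum_{0\leq j\leq E} \frac{\left(\!\binom{K-1}{E-j}\!\right)}{\left(\!\binom{K}{E}\!\right)}\,|j\rangle .$$
   Context: For $N\geq 1$ write $\boldsymbol{N}=\{0,1,\ldots,N-1\}\subseteq\mathbb{N}$. For $K\in\mathbb{N}$ and $0\leq i\leq (N-1)\cdot K$, the $N$-nomial coefficient is $$C_{N}(K,i) := \big|\{(n_1,\ldots,n_K)\in\boldsymbol{N}^{K} \mid n_1+\cdots+n_K = i\}\big|.$$ For $m\geq 1$ and $j\geq 0$, the multichoose coefficient is $$\left(\!\!\binom{m}{j}\!\!\right) := \frac{(m+j-1)!}{(m-1)!\cdot j!}.$$ A multiset over a set $X$ is a function $\varphi\colon X\to\mathbb{N}$ with finite support. Its size is $\|\varphi\| := \sum_{x}\varphi(x)$, and its multiset coefficient is $(\varphi) := \|\varphi\|!/\prod_{x}\varphi(x)!$. For $0\leq i\leq (N-1)\cdot K$, $\mathcal{M}[K,i](\boldsymbol{N})$ is the set of multisets $\varphi$ over $\boldsymbol{N}$ with $\|\varphi\|=K$ and $\sum_{0\leq j<N}\varphi(j)\cdot j=i$. $\mathcal{D}(X)$ is the set of finitely supported probability distributions on $X$; a formal sum $\sum_k r_k|x_k\rangle$ denotes the distribution giving weight $r_k$ to $x_k$. For $N,K\geq 1$ and $0\leq i\leq (N-1)\cdot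 K$, the Boltzmann-on-numbers distribution $\mathrm{BoN}[N,K](i)\in\mathcal{D}(\boldsymbol{N})$ is $$\mathrm{BoN}[N,K](i) := \sum_{0\leq j<N}\ \sum_{\varphi\in\mathcal{M}[K,i](\boldsymbol{N})} \frac{(\varphi)\cdot\varphi(j)}{C_{N}(K,i)\cdot K}\,|j\rangle .$$ *)

(* Defs.v *)
From mathcomp Require Import all_boot all_order all_algebra.
From mathcomp Require Import finmap multiset.

Set Implicit Arguments.
Unset Strict Implicit.
Unset Printing Implicit Defensive.

Import Order.TTheory GRing.Theory Num.Theory.
Local Open Scope mset_scope.
Local Open Scope fset_scope.
Local Open Scope ring_scope.

(* The set {0, ..., N-1} is 'I_N. *)
Definition Nnomial (N K i : nat) : nat :=
  #|[set t : K.-tuple 'I_N | (\sum_(k < K) tnth t k)%N == i]|.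

(* Meant for 1 <= m: the subtractions are truncated. *)
Definition multichoose (R : realFieldType) (m j : nat) : R :=
  ((m + j - 1)`!)%:R / ((m - 1)`! * j`!)%:R.

Definition msize (X : choiceType) (phi : {mset X}) : nat :=
  \sum_(x <- finsupp phi) phi x.

Definition mcoef (R : realFieldType) (X : choiceType) (phi : {mset X}) : R :=
  ((msize phi)`!)%:R / (\prod_(x <- finsupp phi) (phi x)`!)%:R.

(* The ambient finite set is that of the multisets of size K over 'I_N; it is
   only needed to make the comprehension finite (see [in_Msets]). *)
Definition Msets (N K i : nat) : {fset {mset 'I_N}} :=
  [fset phi in [fset seq_mset (val t) | t : K.-tuple 'I_N]
     | (msize phi == K) && ((\sum_(j < N) phi j * j)%N == i)].

Record distr (R : realFieldType) (X : choiceType) := Distr {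
  weight :> {fsfun X -> R with 0};
  weight_ge0 : forall x, 0 <= weight x;
  weight_sum1 : \sum_(x <- finsupp weight) weight x = 1
}.

(* The formal sum \sum_k r k | x k >. *)
Fact formal_sum_key : unit. Proof. exact: tt. Qed.
Definition formal_sum (R : realFieldType) (X : choiceType) (I : finType)
    (r : I -> R) (x : I -> X) : {fsfun X -> R with 0} :=
  [fsfun[formal_sum_key] y in [fset x k | k : I] => \sum_(k | x k == y) r k].

Definition BoN_weight (R : realFieldType) (N K i : nat) :
    {fsfun 'I_N -> R with 0} :=
  formal_sum (fun j : 'I_N => \sum_(phi <- Msets N K i)
      (mcoef R phi * (phi j)%:R) / ((Nnomial N K i)%:R * K%:R)) id.

Lemma formal_sumE (R : realFieldType) (X : choiceType) (I : finType)
    (r : I -> R) (x : I -> X) y :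
  formal_sum r x y = \sum_(k | x k == y) r k.
Proof.
rewrite /formal_sum fsfunE; case: ifPn => // ynx; rewrite big_pred0 // => k.
by apply: contraNF ynx => /eqP <-; apply/imfsetP; exists k.
Qed.

Lemma formal_sum_total (R : realFieldType) (X : choiceType) (I : finType)
    (r : I -> R) (x : I -> X) :
  \sum_(y <- finsupp (formal_sum r x)) formal_sum r x y = \sum_k r k.
Proof.
have sub : finsupp (formal_sum r x) `<=` [fset x k | k : I].
  exact: finsupp_sub.
rewrite (big_fset_incl _ sub); last by move=> y _; rewrite mem_finsupp negbK => /eqP.
under eq_bigr do rewrite formal_sumE big_mkcond.
rewrite exchange_big /=; apply: eq_bigr => k _.
have xk : x k \in [fset x k | k : I] by apply/imfsetP; exists k.
rewrite (big_fsetD1 (x k)) //= eqxx big1_seq ?addr0 // => y /=.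
by rewrite !inE eq_sym; case: eqP.
Qed.

Lemma msize_seq_mset (X : choiceType) (s : seq X) : msize (seq_mset s) = size s.
Proof.
have -> : msize (seq_mset s) = size (seq_mset s).
  rewrite -sum1_size sum_mset.
  by apply: eq_bigr => x _; rewrite muln1.
exact: perm_size (perm_eq_seq_mset s).
Qed.

Lemma msizeE (X : finType) (phi : {mset X}) : msize phi = (\sum_x phi x)%N.
Proof.
rewrite /msize [RHS](bigID (fun x => x \in finsupp phi)) /= [X in (_ + X)%N]big1 ?addn0.
  rewrite -[RHS]big_filter; apply: perm_big; apply: uniq_perm; rewrite ?fset_uniq //.
    by apply: filter_uniq; exact: index_enum_uniq.
  by move=> x; rewrite mem_filter mem_index_enum andbT.
by move=> x; rewrite memNfinsupp => /eqP.
Qed.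

Lemma in_Msets (N K i : nat) (phi : {mset 'I_N}) :
  (phi \in Msets N K i) =
    (msize phi == K) && ((\sum_(j < N) phi j * j)%N == i).
Proof.
rewrite !inE andb_idl // => /andP[/eqP sz _]; apply/imfsetP.
have szE : size phi == K.
  by rewrite -sz -[X in msize X]seq_mset_id msize_seq_mset.
by exists (Tuple szE) => //=; rewrite seq_mset_id.
Qed.

Lemma card_arrangements (X : finType) K (f : X -> nat) :
  (\sum_x f x)%N = K ->
  (#|[set t : K.-tuple X | [forall x, count_mem x t == f x]]|
     * \prod_x (f x)`!)%N = K`!.
Proof.
elim: K f => [|K IH] f sf.
  have f0 x : f x = 0%N.
    by apply/eqP; rewrite -leqn0 -sf (bigD1 x) //= leq_addr.
  rewrite big1 => [|x _]; last by rewrite f0.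
  rewrite muln1 (_ : [set _ | _] = [set [tuple]]) ?cards1 //.
  apply/setP=> t; rewrite !inE tuple0 eqxx; apply/forallP=> x.
  by rewrite f0.
pose g x y := (f y - (y == x))%N.
have fib : #|[set t : K.+1.-tuple X | [forall x, count_mem x t == f x]]| =
    (\sum_(x | 0 < f x)
       #|[set t : K.-tuple X | [forall y, count_mem y t == g x y]]|)%N.
  rewrite -sum1_card (partition_big (fun t : K.+1.-tuple X => thead t)
     (fun x => 0 < f x)%N) /=; last first.
    move=> t; rewrite inE => /forallP/(_ (thead t))/eqP <-.
    by rewrite [in X in count_mem _ X](tuple_eta t) /= eqxx.
  apply: eq_bigr => x fx; rewrite -sum1_card.
  rewrite (reindex (fun t : K.-tuple X => [tuple of x :: t])) /=; last first.
    exists (fun t : K.+1.-tuple X => [tuple of behead t]) => [t _|t].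
      by apply: val_inj.
    by rewrite !inE => /andP[_ /eqP <-]; rewrite -tuple_eta.
  apply: eq_bigl => t; rewrite !inE theadE eqxx andbT.
  apply: eq_forallb => y /=; rewrite /g (eq_sym y x).
  case: (x =P y) => [<-|_]; last by rewrite add0n subn0.
  by rewrite add1n subn1 -(prednK fx) /= eqSS.
rewrite fib big_distrl /= factS -{1}sf big_distrl /=.
rewrite [RHS](bigID (fun x => 0 < f x)%N) /= [X in (_ + X)%N]big1 ?addn0; last first.
  by move=> x; rewrite -leqNgt leqn0 => /eqP ->.
apply: eq_bigr => x fx.
have sg : (\sum_y g x y)%N = K.
  have /eqP := sf; rewrite (bigD1 x) //= [in X in _ -> X](bigD1 x) //= /g eqxx.
  rewrite -(prednK fx) addSn eqSS subn1 /= => /eqP <-; congr addn.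
  by apply: eq_bigr => y /negbTE ->; rewrite subn0.
rewrite -(IH _ sg) mulnCA; congr muln.
rewrite (bigD1 x) //= [in RHS](bigD1 x) //= mulnA; congr muln.
  by rewrite /g eqxx -(prednK fx) subn1 /= factS.
by apply: eq_bigr => y /negbTE yx; rewrite /g yx subn0.
Qed.

Lemma mcoefE (R : realFieldType) (X : finType) K (phi : {mset X}) :
  msize phi = K ->
  mcoef R phi = #|[set t : K.-tuple X | seq_mset t == phi]|%:R.
Proof.
move=> sz; have sz' := sz; rewrite msizeE in sz'.
have := card_arrangements sz'.
have -> : [set t : K.-tuple X | [forall x, count_mem x t == phi x]] =
          [set t : K.-tuple X | seq_mset t == phi].
  apply/setP => t; rewrite !inE; apply/forallP/eqP => [h|<- x].
    by apply/msetP => x; rewrite mset_seqE; apply/eqP.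
  by rewrite mset_seqE.
have -> : (\prod_x (phi x)`! = \prod_(x <- finsupp phi) (phi x)`!)%N.
  rewrite [LHS](bigID (fun x => x \in finsupp phi)) /= [X in (_ * X)%N]big1 ?muln1.
    rewrite -[LHS]big_filter; apply: perm_big; apply: uniq_perm; rewrite ?fset_uniq //.
      by apply: filter_uniq; exact: index_enum_uniq.
    by move=> x; rewrite mem_filter mem_index_enum andbT.
  by move=> x; rewrite memNfinsupp => /eqP ->.
rewrite /mcoef sz => <-; rewrite natrM mulfK // pnatr_eq0 -lt0n.
by apply: prodn_gt0 => x; exact: fact_gt0.
Qed.

Lemma sum_tuple_mset (N K : nat) (t : K.-tuple 'I_N) :
  (\sum_(k < K) tnth t k = \sum_(j < N) seq_mset t j * j)%N.
Proof.
under [RHS]eq_bigr do rewrite mset_seqE.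
rewrite -(big_tuple _ _ t xpredT (fun j : 'I_N => (j : nat))) /=.
elim: (val t) => [|a s IH].
  by rewrite big_nil big1.
rewrite big_cons IH; under [RHS]eq_bigr do rewrite /= mulnDl.
rewrite big_split /=; congr addn.
by rewrite (bigD1 a) //= eqxx mul1n big1 ?addn0 // => j; rewrite eq_sym => /negbTE ->.
Qed.

Lemma sum_Msets (R : realFieldType) (N K i : nat) (F : {mset 'I_N} -> R) :
  \sum_(phi <- Msets N K i) mcoef R phi * F phi =
  \sum_(t : K.-tuple 'I_N | (\sum_(k < K) tnth t k)%N == i) F (seq_mset t).
Proof.
transitivity (\sum_(phi <- Msets N K i)
    \sum_(t : K.-tuple 'I_N | seq_mset t == phi) F (seq_mset t)).
  rewrite big_seq [RHS]big_seq; apply: eq_bigr => phi.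
  rewrite in_Msets => /andP[/eqP sz _]; rewrite (mcoefE _ sz).
  rewrite (eq_bigr (fun _ => F phi)) => [|t /eqP -> //].
  by rewrite sumr_const -[RHS]mulr_natl cardsE.
rewrite (exchange_big_dep xpredT) //= [RHS]big_mkcond; apply: eq_bigr => t _.
have tM : (seq_mset t \in Msets N K i) = ((\sum_(k < K) tnth t k)%N == i).
  by rewrite in_Msets msize_seq_mset size_tuple eqxx sum_tuple_mset.
case: ifP tM => _ tM.
  rewrite big_mkcond (big_fsetD1 (seq_mset t)) //= eqxx big1_seq ?addr0 // => y /=.
  by rewrite !inE eq_sym; case: eqP.
rewrite big1_seq // => y /andP[/eqP <-]; by rewrite tM.
Qed.

Lemma Nnomial_gt0 (N K i : nat) :
  (0 < N)%N -> (i <= (N - 1) * K)%N -> (0 < Nnomial N K i)%N.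
Proof.
case: N => // N _; rewrite subn1 /=; rewrite /Nnomial => hi; apply/card_gt0P.
suff [t ht] : exists t : K.-tuple 'I_N.+1, (\sum_(k < K) tnth t k)%N = i.
  by exists t; rewrite inE ht.
elim: K i hi => [|K IH] i hi.
  by exists [tuple]; rewrite big_ord0; move: hi; rewrite muln0 leqn0 => /eqP.
have hm : (minn i N < N.+1)%N by rewrite ltnS geq_minr.
have [|t ht] := IH (i - minn i N)%N.
  rewrite leq_subLR; move: hi; rewrite mulnS.
  by case: (leqP i N) => [/leqW hiN|hiN] //; rewrite leq_addr.
exists [tuple of Ordinal hm :: t]; rewrite big_ord_recl tnth0 /=.
under eq_bigr do rewrite tnthS.
by rewrite ht subnKC // geq_minl.
Qed.

Lemma BoN_weightE (R : realFieldType) (N K i : nat) (j : 'I_N) :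
  BoN_weight R N K i j = \sum_(phi <- Msets N K i)
      (mcoef R phi * (phi j)%:R) / ((Nnomial N K i)%:R * K%:R).
Proof. by rewrite formal_sumE big_pred1_eq. Qed.

Lemma BoN_weight_ge0 (R : realFieldType) (N K i : nat) (j : 'I_N) :
  0 <= BoN_weight R N K i j.
Proof.
rewrite BoN_weightE; apply: sumr_ge0 => phi _.
by rewrite !(mulr_ge0, invr_ge0, ler0n).
Qed.

Lemma BoN_weight_sum1 (R : realFieldType) (N K i : nat) :
  (0 < N)%N -> (0 < K)%N -> (i <= (N - 1) * K)%N ->
  \sum_(j <- finsupp (BoN_weight R N K i)) BoN_weight R N K i j = 1.
Proof.
move=> N0 K0 hi; rewrite formal_sum_total exchange_big /=.
have C0 : (Nnomial N K i)%:R != 0 :> R.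
  by rewrite pnatr_eq0 -lt0n Nnomial_gt0.
have K0' : K%:R != 0 :> R by rewrite pnatr_eq0 -lt0n.
transitivity (\sum_(phi <- Msets N K i) mcoef R phi * (Nnomial N K i)%:R^-1).
  rewrite big_seq [RHS]big_seq; apply: eq_bigr => phi.
  rewrite in_Msets => /andP[/eqP sz _].
  rewrite -mulr_suml -mulr_sumr -natr_sum -msizeE sz -mulrA; congr (_ * _).
  by rewrite mulrC invfM -mulrA mulVf // mulr1.
rewrite sum_Msets sumr_const -[LHS]mulr_natl.
by move: C0; rewrite /Nnomial cardsE; apply: mulfV.
Qed.

Definition BoN (R : realFieldType) (N K i : nat)
    (N_gt0 : (0 < N)%N) (K_gt0 : (0 < K)%N) (hi : (i <= (N - 1) * K)%N) :
    distr R 'I_N :=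
  Distr (@BoN_weight_ge0 R N K i) (BoN_weight_sum1 R N_gt0 K_gt0 hi).

Lemma BoE_range (E K : nat) : (0 < K)%N -> (E <= (E.+1 - 1) * K)%N.
Proof. by move=> K0; rewrite subn1 leq_pmulr. Qed.

Definition BoE (R : realFieldType) (E K : nat) (K_gt0 : (0 < K)%N) :
    distr R 'I_E.+1 :=
  BoN R (ltn0Sn E) K_gt0 (BoE_range E K_gt0).

(* Main.v *)
(* The multiset coefficient counts the tuples inducing a multiset, so the
   weight of BoN[N,K](i) at j is the number of occurrences of j in the tuples
   of sum i, divided by C_N(K,i) K.  Each of the K coordinates contributes
   C_N(K-1,i-j) such occurrences.  For i < N these N-nomial coefficients are
   multichoose coefficients. *)
Require Import Defs.
From mathcomp Require Import all_boot all_order all_algebra.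
From mathcomp Require Import finmap multiset.
From mathcomp Require Import perm.

Set Implicit Arguments.
Unset Strict Implicit.
Unset Printing Implicit Defensive.

Import Order.TTheory GRing.Theory Num.Theory.
Local Open Scope ring_scope.

Lemma NnomialE N K i :
  Nnomial N K i = (\sum_(t : K.-tuple 'I_N | \sum_(k < K) tnth t k == i) 1)%N.
Proof. by rewrite sum1dep_card. Qed.

Lemma Nnomial0 N i : Nnomial N 0 i = (i == 0%N).
Proof.
rewrite NnomialE; under eq_bigl do rewrite big_ord0 eq_sym.
case: eqP => _; last by rewrite big_pred0_eq.
by rewrite sum1_card card_tuple.
Qed.

(** Removing the head [j] is a bijection onto the [K]-tuples of sum [i - j]; when [i < j] the
    remaining entries would need a negative sum. *)
Lemma card_head_fiber N K i (j : 'I_N) :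
  (\sum_(t : K.+1.-tuple 'I_N
       | (\sum_(k < K.+1) tnth t k == i) && (tnth t ord0 == j)) 1)%N
    = (if j <= i then Nnomial N K (i - j) else 0)%N.
Proof.
rewrite (reindex (fun t : K.-tuple 'I_N => [tuple of j :: t])) /=; last first.
  exists (fun t : K.+1.-tuple 'I_N => [tuple of behead t]) => [t _|t].
    by apply: val_inj.
  by rewrite !inE => /andP[_ /eqP <-]; rewrite -tuple_eta.
have sumE (t : K.-tuple 'I_N) :
    (\sum_(k < K.+1) tnth [tuple of j :: t] k = j + \sum_(k < K) tnth t k)%N.
  by rewrite big_ord_recl tnth0; under eq_bigr do rewrite tnthS.
under eq_bigl do rewrite sumE tnth0 eqxx andbT.
case: leqP => [ji|ij].
  by rewrite NnomialE; apply: eq_bigl => t; rewrite -{1}(subnKC ji) eqn_add2l.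
rewrite big_pred0 // => t; apply: contraTF ij => /eqP <-.
by rewrite -leqNgt leq_addr.
Qed.

(** Exchanging coordinates [0] and [k] is an involution that preserves the sum, which reduces the
    count to the head. *)
Lemma card_coord_fiber N K i (j : 'I_N) (k : 'I_K.+1) :
  (\sum_(t : K.+1.-tuple 'I_N
       | (\sum_(l < K.+1) tnth t l == i) && (tnth t k == j)) 1)%N
    = (if j <= i then Nnomial N K (i - j) else 0)%N.
Proof.
rewrite -card_head_fiber.
pose swap (t : K.+1.-tuple 'I_N) := [tuple tnth t (tperm ord0 k l) | l < K.+1].
have swapK : involutive swap.
  by move=> t; apply: eq_from_tnth => l; rewrite !tnth_mktuple tpermK.
rewrite [RHS](reindex_inj (inv_inj swapK)) /=; apply: eq_bigl => t.
rewrite tnth_mktuple tpermL; congr (_ && _); congr (_ == _).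
rewrite (reindex_inj (@perm_inj _ (tperm ord0 k))).
by apply: eq_bigr => l _; rewrite tnth_mktuple.
Qed.

Lemma Nnomial_recl N K i :
  (i < N)%N -> Nnomial N K.+1 i = (\sum_(j < i.+1) Nnomial N K j)%N.
Proof.
move=> iN; rewrite NnomialE (partition_big (fun t => tnth t ord0) xpredT) //=.
under eq_bigr do rewrite card_head_fiber.
(* Since [i < N], every head value [0, ..., i] is available in ['I_N]. *)
rewrite -big_mkcond /= -(big_ord_widen (n1 := i.+1) _ (fun j => Nnomial N K (i - j))) //.
rewrite (reindex_inj rev_ord_inj) /=; apply: eq_bigr => j _.
by rewrite subSS subKn // -ltnS.
Qed.

(* No part of a sum [i < N] can exceed [N - 1], so the bound on the parts is
   vacuous and stars and bars applies. *)
Lemma Nnomial_bin N K i : (i < N)%N -> Nnomial N K.+1 i = 'C(K + i, i).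
Proof.
elim: K i => [|K IH] i iN; rewrite Nnomial_recl //.
  rewrite binn (bigD1 ord0) //= big1.
    by rewrite Nnomial0.
  by move=> j; rewrite Nnomial0 -val_eqE => /negbTE ->.
under eq_bigr => j _ do rewrite IH ?(leq_ltn_trans (leq_ord j) iN) //.
(* What remains is the hockey-stick identity, proved by Pascal's rule. *)
elim: i {iN} => [|i IHi]; first by rewrite big_ord1 !bin0.
by rewrite big_ord_recr IHi addSnnS addSn binS [RHS]addnC.
Qed.

Lemma multichooseE (R : realFieldType) m j :
  multichoose R m.+1 j = 'C(m + j, j)%:R.
Proof.
rewrite /multichoose addSn !subn1 /= -(bin_fact (leq_addl m j)) addnK.
rewrite natrM (mulnC j`!) mulfK // pnatr_eq0 -lt0n muln_gt0.
by rewrite !fact_gt0.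
Qed.

(** Double counting of the pairs of a tuple and a coordinate holding [j]: each coordinate
    contributes equally. *)
Lemma sum_count_mem N K i (j : 'I_N) :
  (\sum_(t : K.+1.-tuple 'I_N | \sum_(k < K.+1) tnth t k == i) count_mem j t
    = if j <= i then K.+1 * Nnomial N K (i - j) else 0)%N.
Proof.
transitivity (\sum_(t : K.+1.-tuple 'I_N | \sum_(k < K.+1) tnth t k == i)
                \sum_(k < K.+1 | tnth t k == j) 1)%N.
  by apply: eq_bigr => t _; rewrite -sum1_count big_tuple.
rewrite (exchange_big_dep xpredT) //=.
under eq_bigr do rewrite card_coord_fiber.
by rewrite sum_nat_const card_ord; case: ifP; rewrite ?muln0.
Qed.

Theorem mainTheorem6 (R : realFieldType) (E K : nat)
    (hE : (1 <= E)%N) (hK : (2 <= K)%N) :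
  BoE R E (ltnW hK) =
    formal_sum (fun j : 'I_E.+1 =>
      multichoose R (K - 1) (E - j) / multichoose R K E) id
    :> {fsfun 'I_E.+1 -> R with 0}.
Proof.
(* With [K.+2] in place of [K], both tuple lengths are successors, as [Nnomial_bin] and
   [multichooseE] require. *)
case: K hK => [|[|K]] // hK; apply/fsfunP => j /=.
rewrite BoN_weightE formal_sumE big_pred1_eq -mulr_suml sum_Msets.
under eq_bigr do rewrite mset_seqE.
rewrite -natr_sum sum_count_mem -ltnS ltn_ord.
rewrite !Nnomial_bin // ?ltnS ?leq_subr // subn1 /= !multichooseE.
(* The number of coordinates [K.+2] cancels against the normalising factor of [BoN]. *)
by rewrite natrM [X in X / _]mulrC -mulf_div mulfV ?pnatr_eq0 // mulr1.
Qed.
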